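(* Let $a,b$ be relatively prime integers with $2\le a<b$. Then the number of exceptional values with respect to $a$ and $b$ is exactly $\frac{(a-3)(b-1)}{2}+\left\lfloor \frac{b}{a}\right\rfloor$.
   Context: For relatively prime positive integers $a_1,\dots,a_n$ (each at least 2), the Frobenius number $g(a_1,\dots,a_n)$ is the largest integer not representable as a nonnegative integer linear combination of $a_1,\dots,a_n$. Given relatively prime $a<b$, an integer $c>b$ (with $a,b,c$ relatively prime) is called an exceptional value with respect to $a$ and $b$ if $g(a,b,c)<g(a,b)$. *)

(* Defs.v *)
From mathcomp Require Import all_boot all_order all_algebra.
From mathcomp Require Import finmap.
From mathcomp Require Import boolp classical_sets cardinality.

Set Implicit Arguments.
Unset Strict Implicit.
Unset Printing Implicit Defensive.

Import Order.TTheory GRing.Theory Num.Theory.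

Local Open Scope classical_set_scope.
Local Open Scope ring_scope.

Definition representable (s : seq nat) (m : int) : Prop :=
  exists k : nat -> nat, m = (\sum_(i < size s) k i * nth 0 s i)%N%:Z.

Definition is_frobenius (s : seq nat) (g : int) : Prop :=
  ~ representable s g /\ forall m : int, ~ representable s m -> m <= g.

(* The default value 0 is only used when no largest non-representable integer
   exists (e.g. when the gcd of [s] is not 1). *)
Definition frobenius (s : seq nat) : int :=
  xget 0 [set g : int | is_frobenius s g].

Lemma is_frobenius_inj (s : seq nat) (g h : int) :
  is_frobenius s g -> is_frobenius s h -> g = h.
Proof.
by move=> [ng maxg] [nh maxh]; apply/le_anti; rewrite maxh // maxg.
Qed.

Lemma frobeniusE (s : seq nat) (g : int) : is_frobenius s g -> frobenius s = g.
Proof.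
move=> fg; rewrite /frobenius.
by apply: (is_frobenius_inj _ fg); apply: (xgetPex 0 (P := is_frobenius s)); exists g.
Qed.

Definition exceptional (a b c : nat) : Prop :=
  [/\ (b < c)%N, gcdn (gcdn a b) c = 1%N
    & frobenius [:: a; b; c] < frobenius [:: a; b]].

(* Main.v *)
Require Import Defs.
From mathcomp Require Import all_boot all_order all_algebra.
From mathcomp Require Import finmap.
From mathcomp Require Import boolp classical_sets cardinality.
From mathcomp Require Import zify ring lra.

Set Implicit Arguments.
Unset Strict Implicit.
Unset Printing Implicit Defensive.

Import Order.TTheory GRing.Theory Num.Theory.

Local Open Scope classical_set_scope.
Local Open Scope ring_scope.

(** For coprime a and b every integer is uniquely x a + y b with 0 <= y < a, and
it is representable iff x >= 0.  As m |-> ab - a - b - m sends (x, y) to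
(-1 - x, a - 1 - y), it exchanges representable and non-representable integers:
the semigroup generated by a and b is symmetric, with Frobenius number
G = ab - a - b.  Adding a generator c to a symmetric semigroup lowers the
Frobenius number iff G becomes representable, i.e. iff G - kc is representable
for some k, iff some kc is not, iff c is not.  So the exceptional values are the
gaps c > b.  By symmetry there are (a-1)(b-1)/2 gaps; those up to b are the
numbers below b not divisible by a, and there are b - 1 - floor(b/a) of them. *)

Lemma card_fset_set_nat (A : set nat) (m n : nat) :
    (forall i, A i -> (m <= i < n)%N) ->
  finite_set A /\ #|` fset_set A|%fset = (\sum_(m <= i < n) `[< A i >])%N.
Proof.
move=> A_sub.
have AE : A = [set` [fset i in [seq i <- index_iota m n | `[< A i >]]]%fset].
  apply/seteqP; split=> i /=; rewrite !inE /= mem_filter mem_index_iota.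
    by move=> Ai; rewrite A_sub // andbT; apply/asboolP.
  by move=> /andP[/asboolP].
rewrite {1 2}AE; split; first exact: finite_fset.
rewrite set_fsetK card_fseq undup_id ?filter_uniq ?iota_uniq // size_filter.
by rewrite -sum1_count big_mkcond; apply: eq_bigr => i _; case: asbool.
Qed.

Lemma representable_rcons (s : seq nat) (c : nat) (m : int) :
  representable (rcons s c) m <-> exists k : nat, representable s (m - (k * c)%N%:Z).
Proof.
have nth_s i : (i < size s)%N -> nth 0%N (rcons s c) i = nth 0%N s i.
  by move=> lt_i; rewrite nth_rcons lt_i.
have nth_c : nth 0%N (rcons s c) (size s) = c by rewrite nth_rcons ltnn eqxx.
split=> [[f ->]|[k [f mE]]].
  exists (f (size s)), f; rewrite size_rcons big_ord_recr /= nth_c PoszD addrK.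
  by congr Posz; apply: eq_bigr => i _; rewrite nth_s.
exists (fun i => if i == size s then k else f i).
rewrite size_rcons big_ord_recr /= eqxx nth_c PoszD; apply/eqP.
rewrite -subr_eq mE; apply/eqP; congr Posz; apply: eq_bigr => i _.
by rewrite nth_s // ltn_eqF.
Qed.

Lemma representable_ge0 (s : seq nat) (m : int) : representable s m -> 0 <= m.
Proof. by move=> [f ->]. Qed.

Lemma representable0 (s : seq nat) : representable s 0.
Proof. by exists (fun=> 0%N); rewrite big1. Qed.

Lemma representableMn (s : seq nat) (k n : nat) :
  representable s n%:Z -> representable s (k * n)%N%:Z.
Proof.
move=> [f [->]]; exists (fun i => k * f i)%N.
by rewrite big_distrr; congr Posz; apply: eq_bigr => i _; rewrite /= mulnA.
Qed.

Lemma representable2P (a b : nat) (m : int) :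
  representable [:: a; b] m <-> exists x y : nat, m = (x * a + y * b)%N%:Z.
Proof.
split=> [[f ->]|[x [y ->]]].
  by exists (f 0%N), (f 1%N); rewrite !big_ord_recl big_ord0 addn0.
by exists (fun i => if i is 0%N then x else y); rewrite !big_ord_recl big_ord0 addn0.
Qed.

Lemma is_frobenius_ex (s : seq nat) (g : int) :
    (forall m, g < m -> representable s m) ->
  exists2 h, is_frobenius s h & h <= g.
Proof.
move=> rep_gt.
pose above n := `[< forall m : int, n%:Z <= m -> representable s m >].
have exN : exists n, above n.
  by exists `|g|.+1; apply/asboolP => m le_m; apply: rep_gt; lia.
have [n /asboolP rep_ge min_n] := ex_minnP exN.
have nrep : ~ representable s (n%:Z - 1).
  case: n rep_ge min_n => [|n] rep_ge min_n; first by move/representable_ge0.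
  rewrite -addn1 PoszD addrK => rep_n; suff: (n < n)%N by rewrite ltnn.
  apply: min_n; apply/asboolP => m; rewrite le_eqVlt => /predU1P[<- //|lt_m].
  by apply: rep_ge; lia.
exists (n%:Z - 1); first split=> // m nrep_m.
  by case: (leP m (n%:Z - 1)) => // lt_m; case: nrep_m; apply: rep_ge; lia.
by case: leP => // lt_g; case: nrep; apply: rep_gt.
Qed.

Lemma frobenius_lt (s : seq nat) (g : int) :
    (forall m, g < m -> representable s m) ->
  frobenius s < g <-> representable s g.
Proof.
move=> rep_gt; have [h frob_h le_hg] := is_frobenius_ex rep_gt.
rewrite (frobeniusE frob_h); case: frob_h => nrep_h max_h.
split=> [lt_hg|rep_g]; first by apply: contrapT => /max_h; rewrite leNgt lt_hg.
by rewrite lt_neqAle le_hg andbT; apply/eqP => hE; rewrite hE in nrep_h.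
Qed.

Definition gap (s : seq nat) (n : nat) : bool := `[< ~ representable s n%:Z >].

(* Indexed by the conductor N, one more than the Frobenius number: unlike the
   latter, which is -1 when 1 is a generator, N is always a natural number. *)
Definition symmetric_semigroup (s : seq nat) (N : nat) : Prop :=
  forall m : int, representable s m <-> ~ representable s (N%:Z - 1 - m).

Section SymmetricSemigroup.

Variables (s : seq nat) (N : nat).
Hypothesis sym_s : symmetric_semigroup s N.

Lemma representable_ge_conductor (m : int) : N%:Z <= m -> representable s m.
Proof. by move=> le_m; apply/sym_s => /representable_ge0; lia. Qed.

Lemma symmetric_is_frobenius : is_frobenius s (N%:Z - 1).
Proof.
split=> [|m nrep_m]; first by move/sym_s; rewrite subrr; apply; apply: representable0.
by case: leP => // lt_m; case: nrep_m; apply: representable_ge_conductor; lia.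
Qed.

Lemma frobenius_rcons_lt (c : nat) :
  frobenius (rcons s c) < frobenius s <-> ~ representable s c%:Z.
Proof.
rewrite (frobeniusE symmetric_is_frobenius) frobenius_lt; last first.
  move=> m lt_m; apply/representable_rcons; exists 0%N.
  by rewrite subr0; apply: representable_ge_conductor; lia.
split=> [/representable_rcons[k /sym_s nrep_kc] rep_c|nrep_c].
  by apply: nrep_kc; rewrite subKr; apply: representableMn.
by apply/representable_rcons; exists 1%N; apply/sym_s; rewrite subKr mul1n.
Qed.

Lemma gap_lt_conductor (n : nat) : gap s n -> (n < N)%N.
Proof.
move=> /asboolP nrep_n; rewrite ltnNge; apply/negP => le_Nn; apply: nrep_n.
exact: representable_ge_conductor.
Qed.

Lemma gap_rev (n : nat) : (n < N)%N -> gap s (N - n.+1) = ~~ gap s n.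
Proof.
move=> lt_n; rewrite /gap [in RHS]asbool_neg negbK; apply: asbool_equiv_eq.
have -> : (N - n.+1)%N%:Z = N%:Z - 1 - n%:Z by lia.
exact: iff_sym (sym_s n).
Qed.

Lemma sum_gap_symmetric (M : nat) : (N <= M)%N ->
  (\sum_(0 <= i < M) gap s i).*2%N = N.
Proof.
move=> le_NM; rewrite (big_cat_nat _ le_NM) //= [X in (_ + X)%N]big_nat_cond.
rewrite [X in (_ + X)%N]big1 ?addn0 => [|i /andP[/andP[le_Ni _] _]]; last first.
  by apply/eqP; rewrite eqb0; apply/negP => /gap_lt_conductor; rewrite ltnNge le_Ni.
rewrite big_mkord -addnn {1}(reindex_inj rev_ord_inj) -big_split /=.
rewrite (eq_bigr (fun=> 1%N)) ?sum1_card ?card_ord // => i _.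
by rewrite gap_rev //; case: gap.
Qed.

End SymmetricSemigroup.

Section TwoGenerators.

Variables (a b : nat).
Hypotheses (a_gt0 : (0 < a)%N) (co_ab : coprime a b).

Lemma canonical_form (m : int) :
  exists x : int, exists2 y : nat, (y < a)%N & m = x * a%:Z + (y * b)%N%:Z.
Proof.
have [[u v] /= uvE] := coprimezP a%:Z b%:Z co_ab.
have mv_ge0 : 0 <= (m * v %% a)%Z by rewrite modz_ge0 //; lia.
have mv_lt : (m * v %% a)%Z < a by rewrite ltz_pmod.
exists (m * u + (m * v %/ a)%Z * b%:Z), `|(m * v %% a)%Z|%N; first lia.
rewrite PoszM gez0_abs // -[LHS]mulr1 -uvE mulrDr mulrA mulrA.
by rewrite {1}(divz_eq (m * v) a); ring.
Qed.

Lemma representable_canonical (x : int) (y : nat) : (y < a)%N ->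
  representable [:: a; b] (x * a%:Z + (y * b)%N%:Z) <-> 0 <= x.
Proof.
move=> lt_ya; split=> [/representable2P[x' [y' eq_xy]]|x_ge0]; last first.
  by apply/representable2P; exists `|x|%N, y; rewrite PoszD !PoszM gez0_abs.
have eq_diff : (x - x'%:Z) * a%:Z = (y'%:Z - y%:Z) * b%:Z.
  by move: eq_xy; rewrite PoszD !PoszM => eq_xy; lia.
have : (a%:Z %| (y'%:Z - y%:Z) * b%:Z)%Z by rewrite -eq_diff dvdz_mull.
rewrite Gauss_dvdzl // => /dvdzP[k kE].
have k_ge0 : 0 <= k by nia.
have -> : x = x'%:Z + k * b%:Z; last by rewrite addr_ge0 ?mulr_ge0.
apply: (@mulIf _ a%:Z); first lia.
by rewrite mulrDl mulrAC -kE -eq_diff; ring.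
Qed.

Lemma coprime_symmetric_semigroup : (0 < b)%N ->
  symmetric_semigroup [:: a; b] (a.-1 * b.-1).
Proof.
move=> b_gt0 m; have [x [y lt_ya ->]] := canonical_form m.
have -> : (a.-1 * b.-1)%N%:Z - 1 - (x * a%:Z + (y * b)%N%:Z) =
    (- 1 - x) * a%:Z + ((a - y.+1) * b)%N%:Z.
  by rewrite !PoszM -!subn1 -!subzn // intS; ring.
rewrite !representable_canonical ?ltn_subrL //; lia.
Qed.

End TwoGenerators.

Lemma gap2_lt (a b n : nat) : (n < b)%N -> gap [:: a; b] n = ~~ (a %| n)%N.
Proof.
move=> lt_nb; rewrite /gap asbool_neg; congr (~~ _).
apply/asboolP/dvdnP => [/representable2P[x [[|y] [nE]]]|[x ->]].
- by exists x; rewrite nE addn0.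
- by move: lt_nb; rewrite nE mulSn ltnNge addnCA leq_addr.
- by apply/representable2P; exists x, 0%N; rewrite addn0.
Qed.

Lemma sum_gap2_le (a b : nat) : (1 < a)%N -> (0 < b)%N -> coprime a b ->
  (\sum_(0 <= i < b.+1) gap [:: a; b] i + b %/ a + 1 = b)%N.
Proof.
move=> a_gt1 b_gt0 co_ab.
have gap_b : gap [:: a; b] b = false.
  by apply/asboolPn; rewrite notK; apply/representable2P;
    exists 0%N, 1%N; rewrite mul1n.
have ndvd_b : (a %| b)%N = false.
  by apply/negP => /gcdn_idPl; rewrite (eqP co_ab) => aE; rewrite -aE in a_gt1.
rewrite divn_count_dvd !big_nat_recr //= gap_b ndvd_b !addn0.
rewrite big_ltn // gap2_lt // dvdn0 add0n -big_split /=.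
rewrite (eq_big_nat _ _ (F2 := fun=> 1%N)) => [|i /andP[_ lt_ib]].
  by rewrite sum_nat_const_nat muln1 subnK.
by rewrite gap2_lt //; case: (a %| i)%N.
Qed.

Lemma exceptional_gap (a b c : nat) : (0 < a)%N -> (0 < b)%N -> coprime a b ->
  exceptional a b c <-> (b < c)%N /\ gap [:: a; b] c.
Proof.
move=> a_gt0 b_gt0 co_ab.
have exc_lt := frobenius_rcons_lt (coprime_symmetric_semigroup a_gt0 co_ab b_gt0).
split=> [[lt_bc _ /exc_lt nrep_c]|[lt_bc /asboolP nrep_c]].
  by split=> //; apply/asboolP.
by split=> //; [rewrite (eqP co_ab) gcd1n | apply/exc_lt].
Qed.

Lemma card_exceptional (a b : nat) : (0 < a)%N -> (0 < b)%N -> coprime a b ->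
  finite_set [set c | exceptional a b c] /\
  #|` fset_set [set c | exceptional a b c]|%fset =
    (\sum_(b.+1 <= c < a * b) gap [:: a; b] c)%N.
Proof.
move=> a_gt0 b_gt0 co_ab.
have excP c := exceptional_gap c a_gt0 b_gt0 co_ab.
have sym_ab := coprime_symmetric_semigroup a_gt0 co_ab b_gt0.
have [|fin_exc ->] := @card_fset_set_nat [set c | exceptional a b c] b.+1 (a * b).
  by move=> c /excP[lt_bc /(gap_lt_conductor sym_ab)]; nia.
split=> //; apply: eq_big_nat => c /andP[lt_bc _]; congr nat_of_bool.
by apply/asboolP/idP => [/excP[]|gap_c] //; apply/excP.
Qed.

Theorem theorem4 (a b : nat) (a_ge2 : (2 <= a)%N) (lt_ab : (a < b)%N)
    (co_ab : coprime a b) :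
  finite_set [set c : nat | exceptional a b c] /\
  (#|` fset_set [set c : nat | exceptional a b c]|%fset)%:R =
    (a%:R - 3) * (b%:R - 1) / 2 + (b %/ a)%N%:R :> rat.
Proof.
have a_gt0 : (0 < a)%N by lia.
have b_gt0 : (0 < b)%N by lia.
have [fin_exc ->] := card_exceptional a_gt0 b_gt0 co_ab; split=> //.
have sym_ab := coprime_symmetric_semigroup a_gt0 co_ab b_gt0.
have := sum_gap_symmetric sym_ab (leq_mul (leq_pred a) (leq_pred b)).
rewrite (big_cat_nat (n := b.+1)) //=; last nia.
have := sum_gap2_le a_ge2 b_gt0 co_ab.
set low := (\sum_(0 <= i < b.+1) _)%N; set high := (\sum_(b.+1 <= i < _) _)%N.
move=> lowE sumE.
have : low%:R + (b %/ a)%N%:R + 1 = b%:R :> rat by rewrite -[in RHS]lowE !natrD.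
have : (low%:R + high%:R) * 2 = (a%:R - 1) * (b%:R - 1) :> rat.
  by rewrite -natrD -natrM muln2 sumE natrM -!subn1 !natrB.
lra.
Qed.
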